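(* Let $G$ be a finite $2$-Frobenius group such that its Fitting subgroup $F$ is abelian of squarefree exponent. Assume that $\pi(F)\subseteq\{2,3\}$ and that one of the following conditions holds: (a) $G/F\cong C_3\rtimes C_2$, $F$ is a $2$-group, and $\Gamma_{\mathrm{GK}}(G)$ is $(2\quad 3)$; (b) $G/F\cong C_5\rtimes C_2$, $3$ divides $|F|$, and $\Gamma_{\mathrm{GK}}(G)$ is $(2-3\quad 5)$; (c) $G/F\cong C_5\rtimes C_2$, $F$ is a $2$-group, and $\Gamma_{\mathrm{GK}}(G)$ is $(2\quad 5)$; (d) $G/F\cong C_5\rtimes C_4$, $F$ is a $2$-group, and $\Gamma_{\mathrm{GK}}(G)$ is $(2\quad 5)$; (e) $G/F\cong C_7\rtimes C_3$, $2$ divides $|F|$, and $\Gamma_{\mathrm{GK}}(G)$ is $(2-3\quad 7)$; (f) $G/F\cong C_7\rtimes C_3$, $F$ is a $3$-group, and $\Gamma_{\mathrm{GK}}(G)$ is $(3\quad 7)$; (g) $G/F\cong C_7\rtimes C_6$, and $\Gamma_{\mathrm{GK}}(G)$ is $(2-3\quad 7)$; (h) $G/F\cong C_{13}\rtimes C_6$, and $\Gamma_{\mathrm{GK}}(G)$ is $(2-3\quad 13)$. Then $G$ is character-quadratic and semi-rational.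
   Context: All groups are finite. $\pi(X)$ is the set of prime divisors of $|X|$. $C_n$ denotes a cyclic group of order $n$, and $C_n\rtimes C_m$ here denotes a Frobenius group with kernel $C_n$ and complement $C_m$. A group $G$ is a $2$-Frobenius group if it has two normal subgroups $N\le K$ such that $K$ is a Frobenius group with kernel $N$, and $G/N$ is a Frobenius group with kernel $K/N$ (in this situation $N$ is the Fitting subgroup of $G$). The Gruenberg-Kegel graph $\Gamma_{\mathrm{GK}}(G)$ is the simple undirected graph with vertex set $\pi(G)$, two distinct vertices $p,q$ being adjacent if and only if $G$ contains an element of order $pq$. The notation $(p\quad q)$ denotes the graph with vertices $p,q$ and no edges; $(p-q\quad r)$ denotes the graph with vertices $p,q,r$ and the single edge joining $p$ and $q$. For $\chi\in\mathrm{Irr}(G)$ (the set of complex irreducible characters of $G$), $\mathbb{Q}(\chi)=\mathbb{Q}(\chi(g)\mid g\in G)$; for $x\in G$, $\mathbb{Q}(x)=\mathbb{Q}(\psi(x)\mid \psi\in\mathrm{Irr}(G))$. $G$ is semi-rational if $[\mathbb{Q}(x):\mathbb{Q}]\le 2$ for every $x\in G$ (equivalently, for every $x\in G$ the generators of $\langle x\rangle$ lie in at most two conjugacy classes of $G$). $G$ is character-quadratic if $[\mathbb{Q}(\chi):\mathbb{Q}]\le 2$ for every $\chi\in\mathrm{Irr}(G)$. *)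

(* Defs.v *)
From mathcomp Require Import all_boot all_order all_fingroup all_algebra.
From mathcomp Require Import all_solvable all_field all_character.

Set Implicit Arguments.
Unset Strict Implicit.
Unset Printing Implicit Defensive.

Local Open Scope group_scope.

Definition squarefree (n : nat) : Prop := forall p, prime p -> ~~ (p ^ 2 %| n)%N.

Definition two_Frobenius (gT : finGroupType) (G : {group gT}) : Prop :=
  exists N K : {group gT},
    [/\ N <| G, K <| G, N \subset K,
        [Frobenius K with kernel N] & [Frobenius G / N with kernel K / N]].

(* L is isomorphic to C_n ><| C_m, where this notation stands for a Frobenius
   group with cyclic kernel of order n and cyclic complement of order m. *)
Definition Frobenius_cyclic (gT : finGroupType) (L : {group gT}) (n m : nat) :
    Prop :=
  exists A B : {group gT},
    [/\ [Frobenius L = A ><| B], cyclic A, #|A| = n, cyclic B & #|B| = m].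

Definition GK_adj (gT : finGroupType) (G : {group gT}) : rel nat :=
  fun p q => [&& p \in \pi(G), q \in \pi(G), p != q
               & [exists x in G, #[x] == (p * q)%N]].

(* The Gruenberg-Kegel graph of G has vertex set V and undirected edge set E,
   each edge being listed in E with one (arbitrary) orientation. *)
Definition GK_graph_is (gT : finGroupType) (G : {group gT})
    (V : seq nat) (E : seq (nat * nat)) : Prop :=
  \pi(G) =i V /\
  forall p q : nat, GK_adj G p q = ((p, q) \in E) || ((q, p) \in E).

(* The degree [Q(s) : Q]: num_field_exists s provides an extension Qs of rat
   with an embedding in algC, generated by the preimages of the elements of s,
   i.e., an abstract copy of the subfield Q(s) of algC. *)
Definition Qdegree (s : seq algC) : nat :=
  let: existT Qs _ := num_field_exists s in \dim {: Qs}.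

Definition character_quadratic (gT : finGroupType) (G : {group gT}) : Prop :=
  forall i : Iirr G, Qdegree [seq ('chi_i g)%R | g in G] <= 2.

Definition semi_rational (gT : finGroupType) (G : {group gT}) : Prop :=
  forall x, x \in G -> Qdegree [seq ('chi[G]_i x)%R | i : Iirr G] <= 2.

(* Main.v *)
Require Import Defs.
From mathcomp Require Import all_boot all_order all_fingroup all_algebra.
From mathcomp Require Import all_solvable all_field all_character.

(** The proof turns both claims into one pigeonhole statement about exponents.
The group Gal(Q(zeta_|G|)/Q) acts on character values by
chi(x) |-> chi(x ^ k), with k prime to |G|.  A field generated by such values
has degree at most 2 as soon as among any three automorphisms two agree on
them (Qdegree_le2).  So it suffices to find, among any three exponents prime
to |G|, two exponents k and l with x ^ k conjugate to x ^ l (for a fixed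
element x), or with chi(x ^ k) = chi(x ^ l) for all x (for a fixed chi).

Write F for the Fitting subgroup, G / F = A ><| B with |A| = r prime and
|B| = m, and L for the preimage of A in G.  In a 2-Frobenius group no
nontrivial element of F commutes with an element of L \ F
(two_Frobenius_regular), and this fact has three consequences.

- On F and on G \ L, the class of x ^ k depends only on k modulo n, for any
  common multiple n of m and of the exponent of F (expg_class_eqmod).  Such an x
  is b * f with f in F and b ^ m = 1, because G splits over F; modulo the
  commutators [x, u] with u in F, the elements b and f commute, so that
  x ^ e = b ^ e * f ^ e is itself such a commutator when n divides e, and
  multiplying x by a commutator [x, u] conjugates it.

- On L \ F, cosets of F are F-classes, so x ^ k and x ^ l are conjugate in G
  as soon as they are conjugate modulo F.  This is decided by the orbits of B on
  A \ {1}: there are (r - 1) / m of them.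

- An irreducible character vanishes at x if its kernel does not contain some
  normal subgroup N with C_N(x) = 1 (irr_vanish).  Hence each irreducible
  character is supported either on F and G \ L (kernel not containing F), or on
  L (kernel containing F but not L), or it factors through G / L; on each of
  these domains a single rule for k and l is available.

In all eight cases (r - 1) / m is at most 2, and n can be chosen among 2, 3, 4
and 6, so that there are at most two units modulo n. *)

Set Implicit Arguments.
Unset Strict Implicit.
Unset Printing Implicit Defensive.

Import Order.TTheory GRing.Theory Num.Theory.
Local Open Scope group_scope.

(** * Fields of degree at most two *)

(** When [E] is an equivalence on [P] this says that it has at most two
classes. The pigeonhole form needs no set of classes and goes backwards along
maps. *)
Definition two_classes (T : Type) (P : T -> Prop) (E : T -> T -> Prop) : Prop :=
  forall a b c, P a -> P b -> P c -> [\/ E a b, E a c | E b c].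

Lemma two_classes_impl (T S : Type) (f : S -> T) (P : T -> Prop) (Q : S -> Prop)
    (E : T -> T -> Prop) (E' : S -> S -> Prop) :
    (forall a, Q a -> P (f a)) ->
    (forall a b, Q a -> Q b -> E (f a) (f b) -> E' a b) ->
  two_classes P E -> two_classes Q E'.
Proof.
move=> QP EE' two a b c Qa Qb Qc.
by case: (two _ _ _ (QP _ Qa) (QP _ Qb) (QP _ Qc)) => Eab;
  [constructor 1 | constructor 2 | constructor 3]; apply: EE'.
Qed.

(** Induction on the generators of a number field: adjoining one algebraic
element only adds polynomials in it. *)
Lemma adjoin_seq_ind (L : fieldExtType rat) (s : seq L) (P : L -> Prop) :
    (forall a : rat, P (a%:A)%R) ->
    (forall x y, P x -> P y -> P (x + y)%R) ->
    (forall x y, P x -> P y -> P (x * y)%R) ->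
    {in s, forall x, P x} ->
  {in <<1 & s>>%VS, forall x, P x}.
Proof.
move=> PQ PD PM; elim/last_ind: s => [_ x | s y IHs Ps x].
  by rewrite Fadjoin_nil => /vlineP[a ->].
have {}IHs: {in <<1 & s>>%VS, forall x, P x}.
  by apply: IHs => z sz; apply: Ps; rewrite mem_rcons inE sz orbT.
rewrite adjoin_rcons => /Fadjoin_polyP[p /polyOverP Kp ->].
have Py: P y by apply: Ps; rewrite mem_rcons mem_head.
have PX i: P (y ^+ i)%R.
  elim: i => [|i IHi]; last by rewrite exprS; apply: PM.
  by rewrite expr0 -(scale1r 1%R); apply: PQ.
rewrite horner_coef; elim/big_ind: _ => [||i _]; last by apply/PM/PX/IHs/Kp.
  by rewrite -(scale0r 1%R); apply: PQ.
exact: PD.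
Qed.

Lemma num_field_generator (L : fieldExtType rat) :
  exists z : L, <<1; z>>%VS = fullv.
Proof.
exists (separable_generator 1%AS {:L}%AS).
rewrite -eq_adjoin_separable_generator ?sub1v //.
apply/separableP=> x _; apply: pcharf0_separable => p.
by rewrite (fmorph_pchar (in_alg L)) pchar_num.
Qed.

(** Let z generate Q(s). Since s consists of character values of G, z lies in
the cyclotomic field Q(zeta_|G|), which is Galois over Q, so its minimal
polynomial is the product of the X - w over the distinct conjugates w of z.
Each conjugate comes from an automorphism of [algC], which is determined on z
by its action on s; hence there are at most two of them. *)
Lemma Qdegree_le2 (gT : finGroupType) (G : {group gT}) (s : seq algC) :
    {in s, forall a, exists i, exists2 x, x \in G & a = ('chi[G]_i x)%R} ->
    two_classes (fun _ : {rmorphism algC -> algC} => True)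
      (fun nu1 nu2 => {in s, nu1 =1 nu2}) ->
  Qdegree s <= 2.
Proof.
move=> chi_s two; rewrite /Qdegree.
case: (num_field_exists s) => Qs [QsC [s1 Ds genQs]].
have [Qn galQn [QnC gQnC [_ _ Qn_g]]] := group_num_field_exists G.
have [z Dz] := num_field_generator Qs.
have [z' Dz'] : exists z', QnC z' = QsC z.
  have: z \in <<1 & s1>>%VS by rewrite genQs memvf.
  move: z {Dz}; apply: adjoin_seq_ind =>
    [a | x y [x' Dx] [y' Dy] | x y [x' Dx] [y' Dy] | x s1x].
  - by exists (ratr a); rewrite alg_num_field !fmorph_rat.
  - by exists (x' + y')%R; rewrite !rmorphD /= Dx Dy.
  - by exists (x' * y')%R; rewrite !rmorphM /= Dx Dy.
  have [|i [g Gg ->]] := chi_s (QsC x); first by rewrite -Ds map_f.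
  by have [a] := Qn_g _ G _ (irr_char i) g (order_dvdG Gg); exists a.
have {}two: two_classes (fun _ => True)
                        (fun x1 x2 : gal_of {:Qn} => x1 z' = x2 z').
  have nu_of (x : gal_of {:Qn}) :
    {nu : {rmorphism algC -> algC} | {morph QnC: a / x a >-> nu a}}.
    exact: (extend_algC_subfield_aut QnC x).
  apply: (two_classes_impl (f := fun x => sval (nu_of x))) two => // x1 x2 _ _.
  case: (nu_of x1) (nu_of x2) => [nu1 Dnu1] [nu2 Dnu2] /= eq12.
  apply: (fmorph_inj QnC); rewrite Dnu1 Dnu2 Dz'.
  have: z \in <<1 & s1>>%VS by rewrite genQs memvf.
  move: z {Dz Dz'}; apply: adjoin_seq_ind =>
    [a | x y Dx Dy | x y Dx Dy | x s1x].
  - by rewrite alg_num_field !fmorph_rat.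
  - by rewrite !rmorphD /= Dx Dy.
  - by rewrite !rmorphM /= Dx Dy.
  by apply: eq12; rewrite -Ds map_f.
have /(galois_factors (sub1v _))/(_ z' (memvf _))[r /= [_ Ur Dp]] := galQn.
have sz_r : size r <= 2.
  case: r Ur {Dp} => [|x1 [|x2 [|x3 r]]] //=.
  rewrite !inE !negb_or -!andbA => /and5P[n12 n13 _ n23 _].
  by case: (two x1 x2 x3) => // /eqP e; rewrite e ?eqxx in n12 n13 n23.
have /polyOver1P[q Dq] := minPolyOver 1%AS z'.
have sz_q : size q = (size r).+1.
  by rewrite -(size_map_poly (in_alg Qn)) -Dq Dp size_prod_XsubC size_map.
have qz : root (map_poly (in_alg Qs) q) z.
  rewrite -(fmorph_root QsC) -Dz' -map_poly_comp.
  have : root (minPoly 1%AS z') z' := root_minPoly _ _.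
  rewrite -(fmorph_root QnC) Dq -map_poly_comp.
  congr (root _ _); apply: eq_map_poly => a /=.
  by rewrite !alg_num_field !fmorph_rat.
have pq : (minPoly 1%AS z %| map_poly (in_alg Qs) q)%R.
  by apply: minPoly_dvdp qz; apply: alg_polyOver.
have := dvdp_leq _ pq; rewrite size_map_poly size_minPoly sz_q ltnS.
rewrite -Dz dim_Fadjoin dimv1 muln1 map_poly_eq0 -size_poly_gt0 sz_q => /(_ isT).
by move=> le_r; apply: leq_trans sz_r.
Qed.

(** * Galois action on character values, and vanishing *)

Section CharacterFields.

Variables (gT : finGroupType) (G : {group gT}).

(** On the cyclic group generated by x a character is a sum of linear ones,
whose values are |G|-th roots of unity; an automorphism raises all of these
roots to the same power. *)
Lemma aut_algC_exponent (nu : {rmorphism algC -> algC}) :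
  {k | coprime k #|G| &
       forall (i : Iirr G) x, x \in G -> nu ('chi_i x)%R = ('chi_i (x ^+ k)%g)%R}.
Proof.
have [w pr_w] := C_prim_root_exists (cardG_gt0 G).
have [k co_k Dk] := aut_prim_rootP nu pr_w.
exists k => // i x Gx; have sxG : <[x]> \subset G by rewrite cycle_subG.
have Xx : x \in <[x]> := cycle_id x.
rewrite -!(cfResE _ sxG) ?groupX //.
have [r ->] := char_sum_irr (cfRes_char <[x]> (irr_char i)).
rewrite !sum_cfunE rmorph_sum; apply: eq_bigr => j _ /=.
have lin_j : ('chi_j \is a linear_char)%R := irr_cyclic_lin j (cycle_cyclic x).
rewrite lin_charX //.
have /(prim_rootP pr_w)[m ->] : ('chi_j x ^+ #|G| = 1)%R.
  by rewrite -lin_charX // expg_cardG // lin_char1.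
by rewrite rmorphXn /= Dk exprAC.
Qed.

Lemma character_Qdegree_le2 (i : Iirr G) :
    two_classes (fun k => coprime k #|G|)
      (fun k l => {in G, forall x, ('chi_i (x ^+ k)%g = 'chi_i (x ^+ l)%g)%R}) ->
  Qdegree [seq ('chi_i g)%R | g in G] <= 2.
Proof.
move=> two; apply: (@Qdegree_le2 _ G) => [_ /imageP[x Gx ->] |].
  by exists i, x.
apply: (two_classes_impl (f := fun nu => s2val (aut_algC_exponent nu))) two.
  by move=> nu _; case: (aut_algC_exponent nu).
move=> nu1 nu2 _ _; case: (aut_algC_exponent nu1) => k co_k Dk.
case: (aut_algC_exponent nu2) => l co_l Dl /= eq_kl _ /imageP[x Gx ->].
by rewrite Dk // Dl // eq_kl.
Qed.

Lemma element_Qdegree_le2 (x : gT) :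
    x \in G ->
    two_classes (fun k => coprime k #|G|)
      (fun k l => x ^+ k \in x ^+ l ^: G) ->
  Qdegree [seq ('chi[G]_i x)%R | i : Iirr G] <= 2.
Proof.
move=> Gx two; apply: (@Qdegree_le2 _ G) => [_ /imageP[i _ ->] |].
  by exists i, x.
apply: (two_classes_impl (f := fun nu => s2val (aut_algC_exponent nu))) two.
  by move=> nu _; case: (aut_algC_exponent nu).
move=> nu1 nu2 _ _; case: (aut_algC_exponent nu1) => k co_k Dk.
case: (aut_algC_exponent nu2) => l co_l Dl /=.
move=> /imsetP[y Gy Dxk] _ /imageP[i _ ->].
by rewrite Dk // Dl // Dxk cfunJ.
Qed.

(** C_G(x) meets N trivially, so it embeds into the centralizer of xN in G /
N. By the second orthogonality relation in G and in G / N, the sum of the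
|chi(x)|^2 over all irreducible characters of G is then at most the sum over
those with N in their kernel, and the other terms must be zero. *)
Lemma irr_vanish (N : {group gT}) (i : Iirr G) x :
    N <| G -> x \in G -> 'C_N[x] = 1 -> ~~ (N \subset cfker ('chi_i)%R) ->
  ('chi_i x = 0)%R.
Proof.
move=> nsNG Gx regx notkeri; have [sNG nNG] := andP nsNG.
have leC : #|'C_G[x]| <= #|'C_(G / N)[coset N x]|.
  have sCN : 'C_G[x] \subset 'N(N) by rewrite subIset ?nNG.
  have tiCN : N :&: 'C_G[x] = 1 by rewrite setIA (setIidPl sNG).
  have -> : #|'C_G[x]| = #|'C_G[x] / N|.
    exact: card_isog (quotient_isog sCN tiCN).
  apply/subset_leq_card/subsetP => _ /morphimP[y Ny /setIP[Gy cxy] ->].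
  have Nx := subsetP nNG x Gx.
  rewrite inE mem_quotient //=; apply/cent1P.
  by rewrite /commute -!morphM // (cent1P cxy).
have := second_orthogonality_relation x Gx; rewrite mulrb class_refl.
have GNx : coset N x \in G / N by apply: mem_quotient.
have := second_orthogonality_relation (coset N x) GNx.
rewrite mulrb class_refl -2!(eq_bigr _ (fun _ _ => normCK _)) sum_norm_irr_quo //.
move=> sumN; rewrite (bigID (fun j => N \subset cfker ('chi[G]_j)%R)) /= sumN.
rewrite (bigD1 i notkeri) /= => sumG.
have: (`|'chi_i x| ^+ 2 <= 0)%R.
  have : (#|'C_G[x]|%:R <= #|'C_(G / N)[coset N x]|%:R :> algC)%R by rewrite ler_nat.
  rewrite -sumG gerDl; apply: le_trans.
  by rewrite lerDl sumr_ge0 // => j _; rewrite exprn_ge0.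
move=> le0; apply/eqP; rewrite -normr_eq0 -sqrf_eq0 eq_le le0.
by rewrite exprn_ge0.
Qed.

End CharacterFields.

(** * Conjugacy of powers *)

Lemma totient_two_classes n :
    0 < n -> totient n <= 2 ->
  two_classes (fun k => coprime k n) (fun k l => k = l %[mod n]).
Proof.
move=> n_gt0 phi_n a b c co_a co_b co_c.
have [|ab] := eqVneq (a %% n) (b %% n); first by constructor 1.
have [|ac] := eqVneq (a %% n) (c %% n); first by constructor 2.
have [|bc] := eqVneq (b %% n) (c %% n); first by constructor 3.
suffices: size [:: a %% n; b %% n; c %% n] <= 2 by [].
apply: leq_trans phi_n.
have -> : totient n = size [seq d <- index_iota 0 n | coprime n d].
  rewrite totient_count_coprime size_filter -sum1_count.
  by rewrite [RHS]big_mkcond; apply: eq_bigr => d _; case: (coprime n d).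
apply: (@uniq_leq_size _ [:: a %% n; b %% n; c %% n]) => [|d].
  by rewrite /= !inE negb_or ab ac bc.
rewrite !inE mem_filter mem_index_iota coprime_sym => /or3P[]/eqP->;
  rewrite ?coprime_modl ?leq0n ?ltn_pmod // ?andbT; assumption.
Qed.

Lemma regular_class_lcoset (gT : finGroupType) (N : {group gT}) x :
  x \in 'N(N) -> 'C_N[x] = 1 -> x ^: N = x *: N.
Proof.
move=> nNx regx; apply/eqP; rewrite eqEcard card_lcoset -index_cent1 regx indexg1.
rewrite leqnn andbT; apply/subsetP=> _ /imsetP[u Nu ->].
by rewrite mem_lcoset -[_ * _]/[~ x, u] commgEr groupM ?memJ_norm ?groupV.
Qed.

(** Since F is abelian, u |-> [b * f, u] is a homomorphism on F. Modulo its
image b and f commute, so (b * f) ^ e = b ^ e * f ^ e up to a commutator [b *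
f, u]; when both powers are trivial, multiplying b * f by that commutator
amounts to conjugating it by u. *)
Lemma abelian_conj_mul_expg (gT : finGroupType) (F : {group gT}) b f e :
    abelian F -> b \in 'N(F) -> f \in F -> b ^+ e = 1 -> f ^+ e = 1 ->
  (b * f) * (b * f) ^+ e \in (b * f) ^: F.
Proof.
move=> cFF nFb Ff be fe; set y := b * f.
have conjb v : v \in F -> v ^ b = v ^ y.
  move=> Fv; rewrite conjgM [in RHS]/conjg (centsP cFF _ _ f) ?memJ_norm //.
  by rewrite mulKg.
have nFy : y \in 'N(F) by rewrite groupM // (subsetP (normG F)).
have FR u : u \in F -> [~ y, u] \in F.
  by move=> Fu; rewrite commgEr groupM ?memJ_norm ?groupV.
have RM u v : u \in F -> v \in F -> [~ y, u] * [~ y, v] = [~ y, u * v].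
  move=> Fu Fv; rewrite commgMJ conjgE (centsP cFF [~ y, u] _ v) ?FR //.
  by rewrite mulKg (centsP cFF [~ y, u] _ [~ y, v]) ?FR.
have RJ u : u \in F -> [~ y, u] ^ b = [~ y, u ^ y].
  by move=> Fu; rewrite conjb ?FR // conjRg [y ^ y]conjgE mulKg.
have RV v : v \in F -> v ^ b = v * [~ y, v^-1].
  move=> Fv; rewrite conjb // commgEr invgK.
  by rewrite (centsP cFF _ _ v^-1) ?mulKVg ?groupV ?memJ_norm.
(* By induction on e: moving b to the left of f ^ e costs [~ y, f ^- e]. *)
suffices [u Fu Du] : exists2 u, u \in F & y ^+ e = b ^+ e * f ^+ e * [~ y, u].
  by rewrite Du be fe !mul1g -conjg_mulR imset_f.
elim: e {be fe} => [|e [u Fu IHe]].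
  by exists 1; rewrite ?group1 // !expg0 commg1 !mulg1.
exists (f ^- e * u ^ y); first by rewrite groupM ?groupV ?groupX ?memJ_norm.
have Ffe : f ^+ e \in F by rewrite groupX.
have step : f ^+ e * [~ y, u] * b = b * (f ^+ e * [~ y, f ^- e * u ^ y]).
  by rewrite conjgC conjMg RV // RJ // -mulgA RM ?groupV ?memJ_norm.
have FRv : [~ y, f ^- e * u ^ y] \in F.
  by rewrite FR // groupM ?groupV ?memJ_norm.
have -> : y ^+ e.+1 = b ^+ e * (f ^+ e * [~ y, u] * b) * f.
  by rewrite expgSr IHe {2}/y !mulgA.
rewrite step; move: [~ y, _] FRv => v Fv.
by rewrite !expgSr -!mulgA (centsP cFF v Fv f Ff).
Qed.

Section FrobeniusKernel.

Variables (gT : finGroupType) (G A B : {group gT}).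
Hypothesis frobG : [Frobenius G = A ><| B].

Lemma Frobenius_expg_compl z : z \in G -> z \notin A -> z ^+ #|B| = 1.
Proof.
case/and3P: (Frobenius_partition frobG) => /eqP <- _ _.
case/bigcupP=> S /setU1P[-> -> // | /imsetP[a _ ->]].
by rewrite conjD1g => /setD1P[_ Bz] _; rewrite -(cardJg B a) expg_cardG.
Qed.

Hypothesis A_pr : prime #|A|.
Hypothesis leA2B : #|A|.-1 <= 2 * #|B|.

(** B acts semiregularly on A \ {1}, so three different orbits would have 3|B|
> |A| - 1 elements in all. As A is cyclic, an equality between powers of a
generator holds for all elements of A with the same b. *)
Lemma Frobenius_prime_ker_two_classes :
  two_classes (fun k => coprime k #|A|)
    (fun k l => exists2 b, b \in B & {in A, forall a, a ^+ k = (a ^+ l) ^ b}).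
Proof.
have [/sdprodP[_ _ nAB _] ntA ntB _ _] := Frobenius_context frobG.
have /cyclicP[a0 defA] := prime_cyclic A_pr.
have a0J k l b : a0 ^+ k = (a0 ^+ l) ^ b ->
  {in A, forall a, a ^+ k = (a ^+ l) ^ b}.
  move=> Dk a; rewrite defA => /cycleP[i ->].
  by rewrite -!expgM ![(i * _)%N]mulnC !expgM Dk !conjXg.
have Aa0 : a0 \in A by rewrite defA cycle_id.
have a0k k : coprime k #|A| -> a0 ^+ k \in A^#.
  move=> co_k; rewrite !inE groupX // andbT -order_dvdn /order -defA.
  by rewrite -prime_coprime // coprime_sym.
have cardB k : coprime k #|A| -> #|a0 ^+ k ^: B| = #|B|.
  by move/a0k=> Ak; rewrite -index_cent1 (Frobenius_reg_compl frobG) // indexg1.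
have subA k : coprime k #|A| -> a0 ^+ k ^: B \subset A^#.
  by move/a0k=> Ak; rewrite class_sub_norm // normD1.
have disj k l : a0 ^+ k \notin a0 ^+ l ^: B ->
  a0 ^+ k ^: B :&: a0 ^+ l ^: B = set0.
  move=> nkl; apply/setP=> z; rewrite !inE; apply: contraNF nkl => /andP[].
  by rewrite class_sym; apply: class_trans.
move=> k l m co_k co_l co_m.
have [/imsetP[b Bb /a0J Dk]|nkl] := boolP (a0 ^+ k \in a0 ^+ l ^: B).
  by constructor 1; exists b.
have [/imsetP[b Bb /a0J Dk]|nkm] := boolP (a0 ^+ k \in a0 ^+ m ^: B).
  by constructor 2; exists b.
have [/imsetP[b Bb /a0J Dl]|nlm] := boolP (a0 ^+ l \in a0 ^+ m ^: B).
  by constructor 3; exists b.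
have: #|a0 ^+ k ^: B :|: a0 ^+ l ^: B :|: a0 ^+ m ^: B| <= #|A^#|.
  by apply: subset_leq_card; rewrite !subUset !subA.
rewrite cardsU setIUl !disj // setU0 cards0 subn0 cardsU disj // cards0 subn0.
have -> : #|A^#| = #|A|.-1 by rewrite [in RHS](cardsD1 1) group1.
rewrite !cardB // => /leq_trans/(_ leA2B).
by rewrite addnn -mul2n -mulSnr leq_pmul2r // cardG_gt0.
Qed.

(** If A is in the kernel, the character factors through G / A, which has
order |B|; otherwise it vanishes outside A, and the orbits of B on A decide.
*)
Lemma Frobenius_irr_two_classes (i : Iirr G) :
    totient #|B| <= 2 ->
  two_classes (fun k => coprime k #|G|)
    (fun k l => {in G, forall x, ('chi_i (x ^+ k)%g = 'chi_i (x ^+ l)%g)%R}).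
Proof.
move=> phiB.
have [/sdprodP[_ defG nAB _] ntA ntB /andP[sAG _] _] := Frobenius_context frobG.
have sBG : B \subset G by rewrite -defG mulG_subr.
have nsAG : A <| G by rewrite /normal sAG -defG mulG_subG normG.
have [sAker|notkerA] := boolP (A \subset cfker ('chi_i)%R).
  apply: (two_classes_impl (f := id)) (totient_two_classes (cardG_gt0 B) phiB).
    by move=> k; apply: coprime_dvdr; apply: cardSg.
  have wlog_le k l : l <= k -> k = l %[mod #|B|] ->
      {in G, forall x, ('chi_i (x ^+ k)%g = 'chi_i (x ^+ l)%g)%R}.
    move=> le_lk /eqP; rewrite eqn_mod_dvd // => /dvdnP[q Dkl] x Gx.
    rewrite -(subnKC le_lk) expgD cfkerMr // (subsetP sAker) //.
    have [Ax | notAx] := boolP (x \in A); first exact: groupX.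
    by rewrite Dkl mulnC expgM Frobenius_expg_compl // expg1n.
  move=> k l _ _ eq_kl x Gx; case/orP: (leq_total k l) => le_kl.
    by apply/esym/wlog_le.
  exact: wlog_le.
apply: (two_classes_impl (f := id)) Frobenius_prime_ker_two_classes.
  by move=> k; apply: coprime_dvdr; apply: cardSg.
move=> k l co_k co_l [b Bb Dk] x Gx.
have [Ax | notAx] := boolP (x \in A).
  by rewrite Dk // cfunJ // (subsetP sBG).
have vanish j : coprime j #|G| -> ('chi_i (x ^+ j)%g = 0)%R.
  move=> co_j; have notAxj : x ^+ j \notin A.
    apply: contra notAx => Axj; rewrite coprime_sym in co_j.
    by rewrite -(expgK co_j Gx) groupX.
  apply: irr_vanish nsAG _ _ notkerA; first exact: groupX.
  apply/trivgP/subsetP=> a /setIP[Aa /cent1P cxa]; apply: contraR notAxj => nta.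
  have A1a : a \in A^# by rewrite in_setD nta.
  apply: (subsetP (Frobenius_cent1_ker frobG A1a)).
  by rewrite inE groupX //; apply/cent1P.
by rewrite !vanish.
Qed.

End FrobeniusKernel.

(** * Extensions of an abelian group by a Frobenius group *)

Section FrobeniusExtension.

Variables (gT : finGroupType) (G F : {group gT}) (A B : {group coset_of F}).
Hypotheses (nsFG : F <| G) (cFF : abelian F).
Hypothesis frobGF : [Frobenius G / F = A ><| B].
Hypothesis A_pr : prime #|A|.
Hypothesis regF : {in G, forall x, coset F x \in A^# -> 'C_F[x] = 1}.

Let nFG : G \subset 'N(F) := normal_norm nsFG.

(** Take x in G outside F whose coset generates A. The coset of x ^ y is that
of some x ^ j; as the coset of F through x ^ j is an F-class, y can be
corrected by an element of F so as to normalize <[x]>. If y is outside the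
preimage of A, the |B|-th power of the corrected element is in F, since
elements of G / F outside A lie in conjugates of B; it also normalizes <[x]>,
which meets F trivially, so it centralizes x and is trivial. *)
Lemma split_decomposition y :
    y \in G -> coset F y \notin A^# ->
  exists b f, [/\ b \in G, f \in F, y = b * f & b ^+ #|B| = 1].
Proof.
move=> Gy notAy; have [sFG _] := andP nsFG.
have [Ay | {}notAy] := boolP (coset F y \in A).
  exists 1, y; split; rewrite ?group1 ?mul1g ?expg1n //.
  apply: coset_idr; rewrite ?(subsetP nFG) //; apply/eqP.
  by move: notAy; rewrite inE Ay andbT negbK inE.
have [/sdprodP[_ defGF nAB _] ntA _ /andP[sAG _] _] := Frobenius_context frobGF.
have [xb Axb ntxb] := trivgPn _ ntA.
have [x Nx Gx Dxb] := morphimP (subsetP sAG _ Axb).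
have A1x : coset F x \in A^# by rewrite inE -Dxb Axb inE ntxb.
have defA : A = <[coset F x]> :> {set _}.
  apply/eqP; rewrite eq_sym eqEcard cycle_subG -Dxb Axb /=.
  by rewrite -(prime_nt_dvdP A_pr _ (order_dvdG Axb)) // order_eq1.
have Ny : y \in 'N(F) := subsetP nFG y Gy.
have A1xy : coset F (x ^ y) \in A^#.
  rewrite morphJ // memJ_norm // normD1.
  by apply: subsetP (mem_quotient F Gy); rewrite -defGF mulG_subG normG.
have [j Dxy] : exists j, coset F (x ^ y) = coset F (x ^+ j).
  have /setD1P[_] := A1xy; rewrite defA => /cycleP[j Dj].
  by exists j; rewrite morphX.
have Gxj : x ^+ j \in G by rewrite groupX.
have /imsetP[u Fu Du] : x ^ y \in x ^+ j ^: F.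
  rewrite regular_class_lcoset ?(subsetP nFG) ?regF -?Dxy //.
  rewrite -norm_rlcoset ?(subsetP nFG) //.
  by apply/rcoset_kercosetP; rewrite ?(subsetP nFG) ?groupJ.
have tiXF k : x ^+ k \in F -> x ^+ k = 1.
  move=> Fxk; apply/set1gP; rewrite -(regF Gx A1x) inE Fxk.
  by rewrite groupX ?cent1id.
exists (y * u^-1), u; split; rewrite ?mulgKV //.
  by rewrite groupM // groupV (subsetP sFG).
set b := y * u^-1.
have Gb : b \in G by rewrite groupM // groupV (subsetP sFG).
have nXb : b \in 'N(<[x]>).
  by rewrite inE -cycleJ cycle_subG conjgM Du conjgK mem_cycle.
have Fbm : b ^+ #|B| \in F.
  have Nb : b \in 'N(F) := subsetP nFG b Gb.
  have Nu : u^-1 \in 'N(F) by rewrite groupV (subsetP (normG F)).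
  have Db : coset F b = coset F y.
    by rewrite morphM //= [X in _ * X]coset_id ?groupV // mulg1.
  apply: coset_idr; rewrite ?groupX // morphX //= Db.
  by rewrite (Frobenius_expg_compl frobGF) ?mem_quotient.
apply/set1gP; rewrite -(regF Gx A1x) inE Fbm /=.
apply/cent1P/commute_sym/commgP; set c := b ^+ _.
have /cycleP[k Dk] : [~ x, c] \in <[x]>.
  by rewrite commgEl groupM ?groupV ?memJ_norm ?groupX ?cycle_id.
apply/eqP; rewrite Dk tiXF // -Dk commgEr groupM ?memJ_norm ?groupV //.
Qed.

Lemma expg_class_split y n e :
    y \in G -> coset F y \notin A^# ->
    exponent F %| n -> #|B| %| n -> n %| e ->
  y * y ^+ e \in y ^: G.
Proof.
move=> Gy notAy dvFn dvBn /dvdnP[q ->].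
have [b [f [Gb Ff -> bm]]] := split_decomposition Gy notAy.
have [sFG _] := andP nsFG.
apply: subsetP (imsetS _ sFG) _ _; apply: abelian_conj_mul_expg => //.
- exact: subsetP nFG _ Gb.
- by rewrite mulnC expgM -(divnK dvBn) mulnC expgM bm !expg1n.
by rewrite mulnC expgM -(divnK dvFn) mulnC expgM expg_exponent // !expg1n.
Qed.

(** With z = y ^ l, the element y is a power of z, so y ^ k is z times a power
of z with exponent divisible by n. *)
Lemma expg_class_eqmod y n k l :
    y \in G -> coset F y \notin A^# ->
    exponent F %| n -> #|B| %| n ->
    coprime k #|G| -> coprime l #|G| -> k = l %[mod n] ->
  y ^+ k \in y ^+ l ^: G.
Proof.
move=> Gy notAy dvFn dvBn.
wlog le_lk : k l / l <= k => [wlog_le co_k co_l eq_kl|].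
  case/orP: (leq_total k l) => le_kl; last exact: wlog_le.
  by rewrite class_sym; apply: wlog_le.
move=> _ co_l /eqP; rewrite eqn_mod_dvd // => dvn.
rewrite coprime_sym in co_l.
have yK := expgK co_l Gy; set j := expg_invn G l in yK.
rewrite -(subnKC le_lk) expgD -{2}yK -expgM.
apply: (@expg_class_split _ n) => //; first exact: groupX; last exact: dvdn_mull.
apply: contra notAy => /setD1P[ntyl Ayl].
have Dy : coset F y = coset F (y ^+ l) ^+ j.
  by rewrite -morphX ?yK // (subsetP nFG) ?groupX.
rewrite !inE Dy groupX // andbT; apply: contra ntyl => /eqP Dyl.
by rewrite morphX ?(subsetP nFG) //= Dy Dyl expg1n.
Qed.

Hypothesis leA2B : #|A|.-1 <= 2 * #|B|.
Variable n : nat.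
Hypotheses (dvFn : exponent F %| n) (dvBn : #|B| %| n) (dvnG : n %| #|G|).
Hypothesis phi_n : totient n <= 2.

Let n_two_classes :
  two_classes (fun k => coprime k #|G|) (fun k l => k = l %[mod n]).
Proof.
apply: (two_classes_impl (f := id)) (totient_two_classes _ phi_n) => //.
  by move=> k; apply: coprime_dvdr.
exact: dvdn_gt0 dvnG.
Qed.

Let sABGF : A \subset G / F /\ B \subset G / F.
Proof.
have [/sdprod_context[nsAG sBG _ _ _] _ _ _ _] := Frobenius_context frobGF.
by split; first exact: normal_sub.
Qed.

Lemma expg_coset_ker x k :
  x \in G -> coprime k #|G| -> coset F x \in A^# -> coset F (x ^+ k) \in A^#.
Proof.
move=> Gx co_k /setD1P[ntx Ax]; have Nx := subsetP nFG x Gx.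
rewrite morphX //= in_setD1 groupX // andbT; apply: contra ntx => /eqP xk1.
have co_xk : coprime #|G / F| k.
  by rewrite coprime_sym (coprime_dvdr (dvdn_quotient _ _)).
by rewrite -(expgK co_xk (mem_quotient F Gx)) xk1 expg1n.
Qed.

Lemma Frobenius_ext_semi_rational : semi_rational G.
Proof.
move=> x Gx; apply: element_Qdegree_le2 => //.
have [A1x | notA1x] := boolP (coset F x \in A^#); last first.
  apply: (two_classes_impl (f := id)) n_two_classes => // k l co_k co_l.
  exact: expg_class_eqmod dvFn dvBn co_k co_l.
apply: (two_classes_impl (f := id))
         (Frobenius_prime_ker_two_classes frobGF A_pr leA2B).
  move=> k; apply: coprime_dvdr; apply: dvdn_trans (cardSg sABGF.1) _.
  exact: dvdn_quotient.
move=> k l co_k co_l [b Bb Dk].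
have [g Ng Gg Db] := morphimP (subsetP sABGF.2 b Bb).
have Nx := subsetP nFG x Gx.
have /setD1P[_ Ax] := A1x.
have A1xk := expg_coset_ker Gx co_k A1x.
have Nxk : x ^+ k \in 'N(F) by rewrite groupX.
have Gxk : x ^+ k \in G by rewrite groupX.
have: x ^+ l ^ g \in x ^+ k ^: F.
  rewrite regular_class_lcoset ?regF // -norm_rlcoset //.
  apply/rcoset_kercosetP; rewrite ?groupJ ?groupX //.
  by rewrite morphJ ?groupX // !morphX //= Dk // Db.
rewrite class_sym => /imsetP[u Fu ->].
by rewrite -conjgM imset_f // groupM // (subsetP (normal_sub nsFG)).
Qed.

Lemma Frobenius_ext_character_quadratic :
  totient #|B| <= 2 -> character_quadratic G.
Proof.
move=> phiB i; apply: character_Qdegree_le2.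
have [sFker | notkerF] := boolP (F \subset cfker ('chi_i)%R).
  have := Frobenius_irr_two_classes frobGF A_pr leA2B (quo_Iirr F i) phiB.
  apply: (two_classes_impl (f := id)) => [k | k l _ _ eq_kl x Gx].
    by apply: coprime_dvdr; apply: dvdn_quotient.
  have := eq_kl _ (mem_quotient F Gx).
  by rewrite -!morphX ?(subsetP nFG) //= quo_IirrE // !cfQuoE ?groupX.
apply: (two_classes_impl (f := id)) n_two_classes => // k l co_k co_l eq_kl x Gx.
have [A1x | notA1x] := boolP (coset F x \in A^#).
  have vanish j : coprime j #|G| -> ('chi_i (x ^+ j)%g = 0)%R.
    move=> co_j; apply: irr_vanish nsFG _ _ notkerF; rewrite ?groupX //.
    by rewrite regF ?groupX // expg_coset_ker.
  by rewrite !vanish.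
have /imsetP[g Gg ->] := expg_class_eqmod Gx notA1x dvFn dvBn co_k co_l eq_kl.
by rewrite cfunJ.
Qed.

End FrobeniusExtension.

(** * 2-Frobenius groups *)

Lemma normal_TI_cents (gT : finGroupType) (G M K : {group gT}) :
  M <| G -> K <| G -> M :&: K = 1 -> M \subset 'C(K).
Proof.
move=> /andP[sMG nMG] /andP[sKG nKG] tiMK; apply/commG1P/trivgP; rewrite -tiMK.
by apply: commg_subI; rewrite subsetI subxx ?(subset_trans sMG) ?(subset_trans sKG).
Qed.

(** Either M meets K, or it commutes with K; in both cases M centralizes a
nontrivial element of K. *)
Lemma Frobenius_abelian_normal_sub_ker (gT : finGroupType) (G K M : {group gT}) :
  [Frobenius G with kernel K] -> M <| G -> abelian M -> M \subset K.
Proof.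
case/Frobenius_kerP=> ntK _ nsKG regK nsMG cMM.
have sMcent y : y \in K^# -> M \subset 'C[y] -> M \subset K.
  by move=> /regK sCK cMy; apply: subset_trans sCK; rewrite subsetI normal_sub.
have [tiMK | /trivgPn[y /setIP[My Ky] nty]] := eqVneq (M :&: K) 1.
  have [y Ky nty] := trivgPn _ ntK; apply: (sMcent y).
    by rewrite in_setD1 nty.
  rewrite -cent_set1 (subset_trans (normal_TI_cents nsMG nsKG tiMK)) // centS //.
  by rewrite sub1set.
apply: (sMcent y); first by rewrite in_setD1 nty.
by rewrite -cent_set1 (subset_trans cMM) // centS // sub1set.
Qed.

Lemma Frobenius_prime_ker_sub (gT : finGroupType) (G A M : {group gT}) :
    [Frobenius G with kernel A] -> prime #|A| -> M <| G -> M :!=: 1 ->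
  A \subset M.
Proof.
move=> /Frobenius_kerP[ntA _ nsAG regA] A_pr nsMG ntM.
apply: prime_meetG => //; apply: contra ntM => /eqP tiAM.
have [y Ay nty] := trivgPn _ ntA.
have sMA : M \subset A.
  have A1y : y \in A^# by rewrite in_setD1 nty.
  apply: subset_trans (regA y A1y); rewrite subsetI normal_sub // -cent_set1.
  rewrite centsC sub1set; exact: subsetP (normal_TI_cents nsAG nsMG tiAM) y Ay.
by rewrite -(setIidPr sMA) tiAM.
Qed.

(** The point is that F is the subgroup N of the 2-Frobenius structure (N, K),
and that A lies in K / F; then regularity is that of the Frobenius group K.
Abelian normal subgroups lie in Frobenius kernels, which gives F <= K from G /
N and then F <= N from K. If N were larger than F, then A would be contained
in N / F, and G / N, a quotient of the abelian group B, would be an abelian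
Frobenius group. *)
Lemma two_Frobenius_regular (gT : finGroupType) (G F : {group gT})
    (A B : {group coset_of F}) :
    two_Frobenius G -> F <| G -> abelian F -> [Frobenius G / F = A ><| B] ->
    prime #|A| -> abelian B ->
  {in G, forall x, coset F x \in A^# -> 'C_F[x] = 1}.
Proof.
move=> [N [K [nsNG nsKG sNK frobK frobGN]]] nsFG cFF frobGF A_pr cBB.
have nNG := normal_norm nsNG; have nFG := normal_norm nsFG.
have sFK : F \subset K.
  have nNF : F \subset 'N(N) := subset_trans (normal_sub nsFG) nNG.
  rewrite -(quotientSGK nNF sNK).
  apply: Frobenius_abelian_normal_sub_ker frobGN _ _.
    exact: quotient_normal.
  exact: quotient_abelian.
have sFN : F \subset N.
  apply: Frobenius_abelian_normal_sub_ker frobK _ cFF.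
  exact: normalS sFK (normal_sub nsKG) nsFG.
have frobGFA := FrobeniusWker frobGF.
have [/sdprodP[_ defGF nAB _] ntA _ _ _] := Frobenius_context frobGF.
have eqNF : N :=: F.
  apply/eqP; rewrite eqEsubset sFN andbT; apply: contraT => notsNF.
  have nFN : N \subset 'N(F) := subset_trans (normal_sub nsNG) nFG.
  have sANF : A \subset N / F.
    apply: Frobenius_prime_ker_sub frobGFA A_pr _ _.
      exact: quotient_normal.
    by rewrite -subG1 quotient_sub1.
  (* G / A is a copy of B, hence abelian, so the derived group is inside A. *)
  have sG'N : G^`(1) \subset N.
    rewrite -(quotientSGK _ sFN) ?(subset_trans (der_sub 1 G)) //.
    rewrite quotient_der //; apply: subset_trans sANF.
    have nsAGF : A <| G / F by case/Frobenius_kerP: frobGFA.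
    apply: der1_min; first exact: normal_norm.
    by rewrite -defGF quotientMidl quotient_abelian.
  have /Frobenius_kerP[_ /proper_subn/negP nsGK _ _] := frobGN; case: nsGK.
  apply: Frobenius_abelian_normal_sub_ker frobGN (normal_refl _) _.
  exact: sub_der1_abelian.
have nFK : K \subset 'N(F) := subset_trans (normal_sub nsKG) nFG.
have sAKF : A \subset K / F.
  apply: Frobenius_prime_ker_sub frobGFA A_pr _ _.
    exact: quotient_normal.
  by have /Frobenius_kerP[ntKN _ _ _] := frobGN; rewrite -eqNF.
move=> x Gx /setD1P[ntx Ax].
have Kx : x \in K.
  have Nx := subsetP nFG x Gx.
  have /morphimP[z Nz Kz /= Dx] := subsetP sAKF _ Ax.
  have /rcosetP[f Ff ->] : x \in F :* z by apply/rcoset_kercosetP.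
  by rewrite groupM // (subsetP sFK).
have /Frobenius_kerP[_ _ _ regN] := frobK.
apply/trivgP/subsetP=> f /setIP[Ff /cent1P cfx]; apply: contraR ntx => ntf.
have N1f : f \in N^# by rewrite in_setD ntf eqNF.
have CKf : x \in 'C_K[f] by rewrite inE Kx; apply/cent1P.
by apply/eqP/coset_id; rewrite -eqNF (subsetP (regN f N1f)).
Qed.

(** * The eight pairs (r, m) *)

Lemma squarefree_dvdn n m :
    0 < n -> squarefree n -> {in \pi(n), forall p, p %| m} -> n %| m.
Proof.
move=> n_gt0 sqf_n dvm; apply/dvdn_partP=> // p pi_p.
have p_pr : prime p by move: pi_p; rewrite mem_primes => /andP[].
rewrite p_part (dvdn_trans _ (dvm p pi_p)) // -[X in _ %| X]expn1 dvdn_exp2l //.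
by rewrite leqNgt -pfactor_dvdn ?sqf_n.
Qed.

(** The last divisibility hypothesis may use m %| #|G| because m, as the order
of B, always divides |G|. *)
Lemma two_Frobenius_quadratic (gT : finGroupType) (G : {group gT}) r m n :
    two_Frobenius G -> abelian 'F(G) -> Frobenius_cyclic (G / 'F(G)) r m ->
    prime r -> r.-1 <= 2 * m -> totient m <= 2 -> totient n <= 2 ->
    exponent 'F(G) %| n -> m %| n -> (m %| #|G| -> n %| #|G|) ->
  character_quadratic G /\ semi_rational G.
Proof.
move=> G_2Frob cFF [A [B [frobGF cycA oA cycB oB]]].
rewrite -oA -oB => A_pr leA2B phiB phi_n dvFn dvBn dvnG.
have nsFG : 'F(G) <| G := Fitting_normal G.
have regF := two_Frobenius_regular G_2Frob nsFG cFF frobGF A_pr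
               (cyclic_abelian cycB).
have [/sdprod_context[_ sBGF _ _ _] _ _ _ _] := Frobenius_context frobGF.
have{dvnG} dvnG : n %| #|G|.
  by apply: dvnG; apply: dvdn_trans (cardSg sBGF) (dvdn_quotient _ _).
split.
  exact: (Frobenius_ext_character_quadratic nsFG cFF frobGF A_pr regF leA2B
           dvFn dvBn dvnG phi_n phiB).
exact: (Frobenius_ext_semi_rational nsFG cFF frobGF A_pr regF leA2B
         dvFn dvBn dvnG phi_n).
Qed.

Theorem theorem2p3 (gT : finGroupType) (G : {group gT})
  (G_2Frob : two_Frobenius G)
  (F_abelian : abelian 'F(G))
  (F_sqfree : squarefree (exponent 'F(G)))
  (F_pi : {subset \pi('F(G)) <= [:: 2; 3]})
  (G_cases :
     (* (a) *)
     [/\ Frobenius_cyclic (G / 'F(G)) 3 2, 2.-group 'F(G)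
       & GK_graph_is G [:: 2; 3] [::]] \/
     (* (b) *)
     [/\ Frobenius_cyclic (G / 'F(G)) 5 2, (3 %| #|'F(G)|)%N
       & GK_graph_is G [:: 2; 3; 5] [:: (2, 3)]] \/
     (* (c) *)
     [/\ Frobenius_cyclic (G / 'F(G)) 5 2, 2.-group 'F(G)
       & GK_graph_is G [:: 2; 5] [::]] \/
     (* (d) *)
     [/\ Frobenius_cyclic (G / 'F(G)) 5 4, 2.-group 'F(G)
       & GK_graph_is G [:: 2; 5] [::]] \/
     (* (e) *)
     [/\ Frobenius_cyclic (G / 'F(G)) 7 3, (2 %| #|'F(G)|)%N
       & GK_graph_is G [:: 2; 3; 7] [:: (2, 3)]] \/
     (* (f) *)
     [/\ Frobenius_cyclic (G / 'F(G)) 7 3, 3.-group 'F(G)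
       & GK_graph_is G [:: 3; 7] [::]] \/
     (* (g) *)
     (Frobenius_cyclic (G / 'F(G)) 7 6 /\
      GK_graph_is G [:: 2; 3; 7] [:: (2, 3)]) \/
     (* (h) *)
     (Frobenius_cyclic (G / 'F(G)) 13 6 /\
      GK_graph_is G [:: 2; 3; 13] [:: (2, 3)])) :
  character_quadratic G /\ semi_rational G.
Proof.
have expF n : {in \pi('F(G)), forall p, p %| n} -> exponent 'F(G) %| n.
  rewrite -pi_of_exponent; apply: squarefree_dvdn F_sqfree.
  exact: exponent_gt0.
have expF6 : exponent 'F(G) %| 6.
  by apply: expF => p /F_pi; rewrite !inE => /orP[] /eqP->.
have expFp (p n : nat) : p.-group 'F(G) -> p %| n -> exponent 'F(G) %| n.
  by move=> pF dvpn; apply: expF => q /(pnatPpi pF)/eqnP->.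
have dvF p : p %| #|'F(G)| -> p %| #|G|.
  by move=> dvpF; apply: dvdn_trans dvpF (cardSg (Fitting_sub G)).
have dv6 : 2 %| #|G| -> 3 %| #|G| -> 6 %| #|G|.
  by move=> dv2 dv3; rewrite (@Gauss_dvd 2 3) // dv2.
have quad r m n := @two_Frobenius_quadratic gT G r m n G_2Frob F_abelian.
case: G_cases => [[frob pF _]|[[frob dv3 _]|[[frob pF _]|[[frob pF _]|]]]].
- by apply: (quad 3 2 2) => //; apply: expFp pF _.
- by apply: (quad 5 2 6) => // dv2; apply: dv6 => //; apply: dvF.
- by apply: (quad 5 2 2) => //; apply: expFp pF _.
- by apply: (quad 5 4 4) => //; apply: expFp pF _.
case=> [[frob dv2 _]|[[frob pF _]|[[frob _]|[frob _]]]].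
- by apply: (quad 7 3 6) => // dv3; apply: dv6 => //; apply: dvF.
- by apply: (quad 7 3 3) => //; apply: expFp pF _.
- exact: (quad 7 6 6).
exact: (quad 13 6 6).
Qed.
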